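(* For $n\ge1$, $$\sum_{\pi\in\mathfrak{S}_n(213)}t^{\mathsf{des}\,\pi}q^{\mathsf{adi}\,\pi}=\sum_{\pi\in\mathfrak{S}_n(132)}t^{\mathsf{des}\,\pi}q^{\mathsf{adi}^*\,\pi}=\sum_{k=0}^{\lfloor (n-1)/2\rfloor}\Big(\sum_{\pi\in\widetilde{\mathfrak{S}}_{n,k}(213)}q^{\mathsf{adi}\,\pi}\Big)t^k(1+t)^{n-1-2k}=\sum_{k=0}^{\lfloor (n-1)/2\rfloor}\Big(\sum_{\pi\in\widetilde{\mathfrak{S}}_{n,k}(132)}q^{\mathsf{adi}^*\,\pi}\Big)t^k(1+t)^{n-1-2k}.$$
   Context: $\mathfrak{S}_n(\tau)$: permutations of $[n]$ avoiding the classical pattern $\tau$. $\mathsf{des}\,\pi=\#\{i\in[n-1]:\pi(i)>\pi(i+1)\}$. Admissible inversions: set $\pi(n+1)=0$; an inversion pair $(\pi(i),\pi(j))$ ($1\le i<j\le n$, $\pi(i)>\pi(j)$) is admissible if $\pi(j)<\pi(j+1)$ or there is $l$ with $i<l<j$ and $\pi(l)<\pi(j)$; $\mathsf{adi}\,\pi$ counts them. Star admissible: set $\pi(0)=n+1$; an inversion pair $(\pi(i),\pi(j))$ with $i<j$ is star admissible if $\pi(i-1)<\pi(i)$ or there is $l$ with $i<l<j$ and $\pi(l)>\pi(i)$; $\mathsf{adi}^*\,\pi$ counts them. $\mathsf{dd}\,\pi$ is the number of $i\in[n]$ with $\pi(i-1)>\pi(i)>\pi(i+1)$ under $\pi(0)=\pi(n+1)=0$;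 $\mathsf{dd}^*\,\pi$ is the same with $\pi(0)=\pi(n+1)=n+1$. $\widetilde{\mathfrak{S}}_{n,k}(213)=\{\pi\in\mathfrak{S}_n(213):\mathsf{dd}\,\pi=0,\mathsf{des}\,\pi=k\}$, $\widetilde{\mathfrak{S}}_{n,k}(132)=\{\pi\in\mathfrak{S}_n(132):\mathsf{dd}^*\,\pi=0,\mathsf{des}\,\pi=k\}$. *)

(* Defs.v *)
(* Permutations of [n] are represented by s : 'S_n = {perm 'I_n};
   the one-line value pi(i) (i in 1..n) is (s (i-1)).+1, so values lie in 1..n. *)
From HB Require Import structures.
From mathcomp Require Import all_boot all_order all_algebra all_fingroup.
Set Implicit Arguments. Unset Strict Implicit. Unset Printing Implicit Defensive.

(* pv s b i = pi(i) for 1 <= i <= n, and the boundary value b otherwise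
   (used for the conventions pi(0), pi(n+1)). *)
Definition pv (n : nat) (s : 'S_n) (b i : nat) : nat :=
  if i is i'.+1 then oapp (fun j : 'I_n => (val (s j)).+1) b (insub i') else b.

Definition contains (n : nat) (s : 'S_n) (tau : seq nat) : bool :=
  [exists f : {ffun 'I_(size tau) -> 'I_n},
     [forall a : 'I_(size tau), forall b : 'I_(size tau),
        ((a < b) ==> (f a < f b)) &&
        ((val (s (f a)) < val (s (f b))) == (nth 0 tau a < nth 0 tau b))]].

Definition avoids (n : nat) (s : 'S_n) (tau : seq nat) : bool := ~~ contains s tau.

Definition des (n : nat) (s : 'S_n) : nat :=
  \sum_(1 <= i < n) (pv s 0 i.+1 < pv s 0 i : nat).

(* admissible inversions, with pi(n+1) = 0 *)
Definition adi (n : nat) (s : 'S_n) : nat :=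
  let p := pv s 0 in
  \sum_(1 <= i < n.+1) \sum_(i.+1 <= j < n.+1)
     ([&& p j < p i &
          (p j < p j.+1) || has (fun l => p l < p j) (index_iota i.+1 j)] : nat).

(* star admissible inversions, with pi(0) = n+1 *)
Definition adi_star (n : nat) (s : 'S_n) : nat :=
  let p := pv s n.+1 in
  \sum_(1 <= i < n.+1) \sum_(i.+1 <= j < n.+1)
     ([&& p j < p i &
          (p i.-1 < p i) || has (fun l => p i < p l) (index_iota i.+1 j)] : nat).

(* double descents with pi(0) = pi(n+1) = 0 *)
Definition dd (n : nat) (s : 'S_n) : nat :=
  let p := pv s 0 in
  \sum_(1 <= i < n.+1) ([&& p i < p i.-1 & p i.+1 < p i] : nat).

(* double descents with pi(0) = pi(n+1) = n+1 *)
Definition dd_star (n : nat) (s : 'S_n) : nat :=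
  let p := pv s n.+1 in
  \sum_(1 <= i < n.+1) ([&& p i < p i.-1 & p i.+1 < p i] : nat).

Definition Stilde213 (n k : nat) (s : 'S_n) : bool :=
  [&& avoids s [:: 2; 1; 3]%N, dd s == 0 & des s == k].

Definition Stilde132 (n k : nat) (s : 'S_n) : bool :=
  [&& avoids s [:: 1; 3; 2]%N, dd_star s == 0 & des s == k].

(* Main.v *)
Require Import Defs.
From HB Require Import structures.
From mathcomp Require Import all_boot all_order all_algebra all_fingroup.
From mathcomp Require Import zify ring.
Import GRing.Theory.
Set Implicit Arguments. Unset Strict Implicit. Unset Printing Implicit Defensive.

(** Reverse-complementation maps 213-avoiders to 132-avoiders, preserves [des]
    and turns [adi], [dd] into [adi_star], [dd_star]; hence only the first and
    third expressions must be compared. A 213-avoiding word with minimum [m] is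
    [L ++ m :: R] with [L], [R] 213-avoiding and every letter of [L] larger than
    every letter of [R]. With [l], [r] the lengths of [L], [R],
      des = des L + des R + [l > 0],   dd = dd L + dd R + [l > 0 and r = 0],
      adi = adi L + adi R + l (r + [r > 0]).
    So both generating functions satisfy
      X_(n+1) = (1 + t) X_n + t \sum_(l + r = n; l, r > 0) q^(l (r + 1)) X_l X_r
    for [n >= 1]: for the first one the factor [1 + t] collects the terms
    [l = 0] and [r = 0], for the gamma expansion it comes from [l = 0] alone,
    since the terms with [r = 0 < l] have a double descent. *)

(** * Statistics of words and their splitting at the minimum *)

(* 1-based indexing with the boundary value 0 on both sides, as in [pv _ 0]. *)
Definition bnth (w : seq nat) (i : nat) : nat := nth 0 (0 :: w) i.

Definition wdes (w : seq nat) : nat :=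
  \sum_(1 <= i < size w) (bnth w i.+1 < bnth w i : nat).

Definition wadi_pair (w : seq nat) (i j : nat) : bool :=
  (bnth w j < bnth w i) &&
    ((bnth w j < bnth w j.+1) ||
       has (fun l => bnth w l < bnth w j) (index_iota i.+1 j)).

Definition wadi (w : seq nat) : nat :=
  \sum_(1 <= i < (size w).+1) \sum_(i.+1 <= j < (size w).+1)
     (wadi_pair w i j : nat).

Definition wdd (w : seq nat) : nat :=
  \sum_(1 <= i < (size w).+1)
     ((bnth w i < bnth w i.-1) && (bnth w i.+1 < bnth w i) : nat).

Lemma bnth_mem (w : seq nat) (i : nat) : 0 < i <= size w -> bnth w i \in w.
Proof. by case: i => // i; exact: mem_nth. Qed.

Lemma bnth_gt_size (w : seq nat) (i : nat) : size w < i -> bnth w i = 0.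
Proof. by move=> wi; rewrite /bnth nth_default. Qed.

Section Decomposition.

Variables (L R : seq nat) (m : nat).
Hypotheses (m_gt0 : 0 < m) (ltmL : {in L, forall x, m < x})
  (ltmR : {in R, forall x, m < x})
  (ltRL : {in L & R, forall x y, y < x}).

Let w := L ++ m :: R.

Lemma size_decomp : size w = (size L + size R).+1.
Proof. by rewrite size_cat addnS. Qed.

Lemma bnth_decompL i : i <= size L -> bnth w i = bnth L i.
Proof. by case: i => // i iL; rewrite /bnth /= nth_cat iL. Qed.

Lemma bnth_decompM : bnth w (size L).+1 = m.
Proof. by rewrite /bnth /= nth_cat ltnn subnn. Qed.

Lemma bnth_decompR i : 0 < i -> bnth w (i + (size L).+1) = bnth R i.
Proof.
case: i => // i _; rewrite /bnth addSn /= nth_cat ltnNge.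
by rewrite (leq_trans (leqnSn _) (leq_addl _ _)) /= addnS subSn ?leq_addl // addnK.
Qed.

Lemma bnth_ltmL i : 0 < i <= size L -> m < bnth L i.
Proof. by move=> /bnth_mem/ltmL. Qed.

Lemma bnth_ltmR i : 0 < i <= size R -> m < bnth R i.
Proof. by move=> /bnth_mem/ltmR. Qed.

Lemma big_decomp (F : nat -> nat) :
  \sum_(1 <= i < (size w).+1) F i =
  \sum_(1 <= i < (size L).+1) F i + F (size L).+1 +
    \sum_(1 <= i < (size R).+1) F (i + (size L).+1).
Proof.
rewrite size_decomp (@big_cat_nat _ _ _ (size L).+1) /=; [|lia|lia].
rewrite -addnA; congr (_ + _); rewrite big_ltn; last lia.
congr (_ + _); rewrite -[(size L).+2]add1n big_addn.
by congr bigop; congr index_iota; lia.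
Qed.

(* Counting the final descent to the boundary value 0 makes the left and right
   factors contribute without a case distinction. *)
Definition wdes0 (v : seq nat) : nat :=
  \sum_(1 <= i < (size v).+1) (bnth v i.+1 < bnth v i : nat).

Lemma wdes0E (v : seq nat) :
  {in v, forall x, 0 < x} -> wdes0 v = wdes v + (0 < size v).
Proof.
move=> v_gt0; rewrite /wdes0 /wdes; case: (posnP (size v)) => [->|sv].
  by rewrite !big_geq.
rewrite big_nat_recr //= bnth_gt_size //; congr (_ + _).
by rewrite v_gt0 // bnth_mem // sv leqnn.
Qed.

(** The letter following [L] is [m], which lies below all of [L] just as the boundary value 0 does,
    so the descents of [L] are unchanged. The letter [m] is a descent only when the boundary follows
    it. *)
Lemma wdes0_decomp : wdes0 w = wdes0 L + (size R == 0) + wdes0 R.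
Proof.
rewrite /wdes0 big_decomp; congr (_ + _ + _).
- apply: eq_big_nat => i /andP[i0 iL].
  rewrite (@bnth_decompL i) //; case: (ltngtP i (size L)) => [ltiL||eqiL].
  + by rewrite bnth_decompL.
  + by lia.
  + rewrite eqiL bnth_decompM (@bnth_gt_size L _.+1) //.
    by have := @bnth_ltmL (size L); lia.
- rewrite bnth_decompM -[(size L).+2]add1n bnth_decompR //.
  case: eqP => [R0|R0]; first by rewrite bnth_gt_size ?R0 // m_gt0.
  by have := @bnth_ltmR 1; lia.
- by apply: eq_big_nat => i /andP[i0 iR]; rewrite -addSn !bnth_decompR.
Qed.

Lemma wdes_decomp : wdes w = wdes L + wdes R + (0 < size L).
Proof.
have gt0 (v : seq nat) : {in v, forall x, m < x} -> {in v, forall x, 0 < x}.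
  by move=> ltmv x /ltmv; exact: leq_trans.
have w_gt0 : {in w, forall x, 0 < x}.
  move=> x; rewrite mem_cat inE => /or3P[/(gt0 _ ltmL)|/eqP->|/(gt0 _ ltmR)] //.
have := wdes0_decomp; rewrite !wdes0E //; try exact: gt0.
by rewrite size_decomp; lia.
Qed.

(** On either side [m] plays the role of the boundary value 0, so letters of [L] and [R] keep their
    status. The letter [m] is a double descent exactly when a letter of [L] precedes it and the
    boundary follows it. *)
Lemma wdd_decomp :
  wdd w = wdd L + wdd R + ((0 < size L) && (size R == 0)).
Proof.
rewrite /wdd big_decomp -addnA [X in _ + X]addnC addnA; congr (_ + _ + _).
- apply: eq_big_nat => i /andP[i0 iL].
  rewrite !(@bnth_decompL i) ?(@bnth_decompL i.-1) //; last lia.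
  case: (ltngtP i (size L)) => [ltiL||eqiL].
  + by rewrite bnth_decompL.
  + by lia.
  + rewrite eqiL bnth_decompM (@bnth_gt_size L _.+1) //.
    by have := @bnth_ltmL (size L); lia.
- apply: eq_big_nat => i /andP[i0 iR]; rewrite -addSn !bnth_decompR //.
  (* The first letter of [R] is preceded by [m] in [w] and by 0 in [R]; both are smaller, so it is a
     double descent in neither word. *)
  case: i i0 iR => // -[|i] _ iR.
    have := @bnth_ltmR 1 iR; rewrite add1n /= bnth_decompM /bnth /=; lia.
  by rewrite [(_ + _).-1]/= bnth_decompR.
- rewrite bnth_decompM -[(size L).+2]add1n bnth_decompR // bnth_decompL //=.
  have -> : (m < bnth L (size L)) = (0 < size L).
    by case: (posnP (size L)) => [->|L0] //; apply: bnth_ltmL; rewrite L0 leqnn.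
  congr (nat_of_bool (_ && _)).
  case: eqP => [R0|R0]; first by rewrite bnth_gt_size ?R0 // m_gt0.
  by have := @bnth_ltmR 1; lia.
Qed.

(** Pairs inside [L] or inside [R] keep their status. A pair from [L] to [m] is admissible iff some
    letter follows [m]. A pair from [L] to [R] is always an inversion, admissible because the
    smaller letter [m] lies in between. No inversion starts at [m]. *)
Lemma wadi_decomp :
  wadi w = wadi L + wadi R + size L * (size R + (0 < size R)).
Proof.
have adiLL i j : 0 < i < j -> j <= size L -> wadi_pair w i j = wadi_pair L i j.
  move=> /andP[i0 ij] jL; rewrite /wadi_pair.
  rewrite !(@bnth_decompL i, @bnth_decompL j) //; try lia.
  congr (_ && (_ || _)).
    case: (ltngtP j (size L)) => [ltjL||eqjL]; [by rewrite bnth_decompL|lia|].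
    rewrite eqjL bnth_decompM (@bnth_gt_size L _.+1) //.
    by have := @bnth_ltmL (size L); lia.
  apply: eq_in_has => k; rewrite mem_index_iota => /andP[ik kj].
  by rewrite bnth_decompL //; lia.
have adiLM i : 0 < i <= size L -> wadi_pair w i (size L).+1 = (0 < size R).
  move=> iL; rewrite /wadi_pair bnth_decompM bnth_decompL ?bnth_ltmL //=; try lia.
  rewrite (_ : has _ _ = false) ?orbF; last first.
    apply/hasPn => k; rewrite mem_index_iota => /andP[ik kL].
    by rewrite -leqNgt bnth_decompL // ltnW // bnth_ltmL //; lia.
  rewrite -[(size L).+2]add1n bnth_decompR //.
  by case: (posnP (size R)) => R0; [rewrite bnth_gt_size ?R0|apply: bnth_ltmR].
have adiLR i j : 0 < i <= size L -> 0 < j <= size R ->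
    wadi_pair w i (j + (size L).+1) = true.
  move=> iL jR; rewrite /wadi_pair bnth_decompR ?(@bnth_decompL i) //; try lia.
  rewrite ltRL ?bnth_mem //=; apply/orP; right; apply/hasP.
  exists (size L).+1; first by rewrite mem_index_iota; lia.
  by rewrite bnth_decompM bnth_ltmR.
have adiMR j : 0 < j <= size R ->
    wadi_pair w (size L).+1 (j + (size L).+1) = false.
  move=> jR; rewrite /wadi_pair bnth_decompR ?bnth_decompM; last lia.
  by rewrite ltnNge ltnW ?bnth_ltmR.
have adiRR i j : 0 < i < j -> j <= size R ->
    wadi_pair w (i + (size L).+1) (j + (size L).+1) = wadi_pair R i j.
  move=> /andP[i0 ij] jR; rewrite /wadi_pair -!addSn !bnth_decompR //; try lia.
  congr (_ && (_ || _)); rewrite /index_iota subnDr [_ + _]addnC iotaDl has_map.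
  apply: eq_in_has => k; rewrite mem_iota => /andP[ik _] /=.
  by rewrite addnC bnth_decompR //; lia.
rewrite {1}/wadi big_decomp -addnA [X in _ + X]addnC addnA.
rewrite [X in _ + X](_ : _ = 0) ?addn0; last first.
  rewrite big_nat big1 // => j; rewrite size_decomp => jR.
  have -> : j = (j - (size L).+1) + (size L).+1 by lia.
  by rewrite adiMR //; lia.
rewrite addnAC; congr (_ + _); last first.
  apply: eq_big_nat => i /andP[i0 iR].
  rewrite size_decomp -addSn big_addn.
  have -> : ((size L + size R).+2 - (size L).+1) = (size R).+1 by lia.
  by apply: eq_big_nat => j jR; rewrite adiRR //; lia.
have -> : size L * (size R + (0 < size R)) =
    \sum_(1 <= i < (size L).+1) (size R + (0 < size R)).
  by rewrite sum_nat_const_nat subn1.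
rewrite -big_split /=; apply: eq_big_nat => i iL.
rewrite size_decomp (@big_cat_nat _ _ _ (size L).+1) /=; [|lia|lia].
congr (_ + _).
  by apply: eq_big_nat => j jL; rewrite adiLL //; lia.
(* The column of [m] contributes [0 < size R], and each of the [size R] columns of [R] contributes
   1. *)
rewrite big_ltn; last lia.
rewrite adiLM // addnC; congr (_ + _).
rewrite (eq_big_nat _ _ (F2 := fun=> 1)); last first.
  move=> j jR; have -> : j = (j - (size L).+1) + (size L).+1 by lia.
  by rewrite adiLR //; lia.
by rewrite sum_nat_const_nat; lia.
Qed.

End Decomposition.

(** * 213-avoiding words and their decomposition at the minimum *)

Definition av213 (w : seq nat) : bool :=
  [forall i : 'I_(size w), forall j : 'I_(size w), forall k : 'I_(size w),
    ~~ [&& i < j, j < k, nth 0 w j < nth 0 w i & nth 0 w i < nth 0 w k]].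

Lemma av213P (w : seq nat) :
  reflect (forall i j k, i < j -> j < k -> k < size w ->
             nth 0 w j < nth 0 w i -> nth 0 w i < nth 0 w k -> False)
          (av213 w).
Proof.
apply: (iffP forallP) => [avw i j k ij jk kw ji ik|avw i].
  have jw := ltn_trans jk kw; have iw := ltn_trans ij jw.
  move: (avw (Ordinal iw)) => /forallP/(_ (Ordinal jw))/forallP/(_ (Ordinal kw)).
  by rewrite /= ij jk ji ik.
apply/forallP => j; apply/forallP => k; apply/negP => /and4P[ij jk].
exact: avw ij jk (ltn_ord k).
Qed.

(** The letters form an interval with arbitrary start [m], so that the factors [L] and [R] of a
    decomposition belong to the same family. *)
Definition AV (n m : nat) : seq (seq nat) :=
  [seq w <- permutations (iota m n) | av213 w].

Lemma mem_AV (n m : nat) (w : seq nat) :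
  (w \in AV n m) = av213 w && perm_eq w (iota m n).
Proof. by rewrite mem_filter mem_permutations. Qed.

Lemma size_AV (n m : nat) (w : seq nat) : w \in AV n m -> size w = n.
Proof. by rewrite mem_AV => /andP[_ /perm_size->]; rewrite size_iota. Qed.

Lemma mem_AV_bounds (n m x : nat) (w : seq nat) :
  w \in AV n m -> x \in w -> m <= x < m + n.
Proof. by rewrite mem_AV => /andP[_ /perm_mem->]; rewrite mem_iota. Qed.

(** Letters [x < y] with [x] in [L] and [y] in [R] would form a pattern 213 with [m] between them.
    So [R] takes the smallest letters above [m] and [L] the remaining ones. *)
Lemma AV_decompP (n m : nat) (w : seq nat) :
  reflect (exists l L R, [/\ l <= n, L \in AV l (m.+1 + (n - l)),
             R \in AV (n - l) m.+1 & w = L ++ m :: R])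
          (w \in AV n.+1 m).
Proof.
apply: (iffP idP) => [|[l [L [R [ln LA RA ->]]]]].
  rewrite mem_AV => /andP[/av213P avw pw].
  have mw : m \in w by rewrite (perm_mem pw) mem_iota; lia.
  case/splitPr: mw avw pw => L R avw pw.
  have sLR : size L + size R = n.
    by have /perm_size := pw; rewrite size_cat size_iota /=; lia.
  have pLR : perm_eq (L ++ R) (iota m.+1 n).
    by move: pw; rewrite perm_catC /= perm_cons perm_sym perm_catC perm_sym.
  have nthR i : nth 0 (L ++ m :: R) ((size L).+1 + i) = nth 0 R i.
    rewrite nth_cat ltnNge (_ : size L <= _) /=; last lia.
    by rewrite addSn subSn ?addKn //; lia.
  have ltRL : {in L & R, forall x y, y < x}.
    move=> x y xL yR; rewrite ltnNge; apply/negP => le_xy.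
    have xm : m < x.
      by have := perm_mem pLR x; rewrite mem_cat xL mem_iota /=; lia.
    have lt_xy : x < y.
      have := perm_uniq pLR; rewrite iota_uniq cat_uniq => /and3P[_ /hasPn dis _].
      by have := dis _ yR; rewrite /= ltn_neqAle le_xy; case: eqP xL => [-> ->|].
    apply: (avw (index x L) (size L) ((size L).+1 + index y R)).
    + by rewrite index_mem.
    + lia.
    + by rewrite size_cat /= addSnnS ltn_add2l ltnS index_mem.
    + by rewrite !nth_cat index_mem xL nth_index // ltnn subnn.
    + by rewrite nthR nth_index // nth_cat index_mem xL nth_index.
  (* By [ltRL], sorted [R] followed by sorted [L] is itself sorted, hence equals the whole interval;
     cutting it after [size R] letters gives the two alphabets. *)
  have [RE LE] : sort leq R = iota m.+1 (size R) /\
                 sort leq L = iota (m.+1 + size R) (size L).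
    have : sort leq R ++ sort leq L = iota m.+1 (size R + size L).
      apply: (sorted_eq leq_trans anti_leq).
      + rewrite sorted_pairwise; last exact: leq_trans.
        rewrite pairwise_cat -!(sorted_pairwise leq_trans).
        rewrite !(sort_sorted leq_total) !andbT; apply/allrelP => y x.
        by rewrite !mem_sort => yR xL; rewrite ltnW ?ltRL.
      + exact: iota_sorted.
      + rewrite perm_catC addnC sLR; apply: perm_trans pLR.
        by apply: perm_cat; rewrite perm_sort.
    rewrite iotaD => /eqP; rewrite eqseq_cat ?size_sort ?size_iota //.
    by case/andP=> /eqP-> /eqP->.
  exists (size L), L, R; split => //; first lia.
  - rewrite mem_AV (_ : n - size L = size R); last lia.
    rewrite -LE perm_sym perm_sort perm_refl andbT.
    apply/av213P => i j k ij jk kL ji ik.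
    apply: (avw i j k) => //; rewrite ?size_cat ?nth_cat; first lia.
      by rewrite (ltn_trans jk kL) (ltn_trans ij (ltn_trans jk kL)).
    by rewrite kL (ltn_trans ij (ltn_trans jk kL)).
  - rewrite mem_AV (_ : n - size L = size R); last lia.
    rewrite -RE perm_sym perm_sort perm_refl andbT.
    apply/av213P => i j k ij jk kL ji ik.
    apply: (avw ((size L).+1 + i) ((size L).+1 + j) ((size L).+1 + k));
      rewrite ?nthR ?size_cat //=; lia.
have sL := size_AV LA; have sR := size_AV RA.
have bL i : i < l -> m.+1 + (n - l) <= nth 0 L i.
  by rewrite -{1}sL => /(mem_nth 0)/(mem_AV_bounds LA)/andP[].
have bR i : i < n - l -> m < nth 0 R i < m.+1 + (n - l).
  by rewrite -{1}sR => /(mem_nth 0)/(mem_AV_bounds RA).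
move: LA RA; rewrite !mem_AV => /andP[/av213P avL pL] /andP[/av213P avR pR].
apply/andP; split; last first.
  rewrite perm_catC /= perm_cons.
  by rewrite -(subnK ln) iotaD perm_cat.
apply/av213P => i j k ij jk; rewrite size_cat /= sL sR => kw.
have nthE h : nth 0 (L ++ m :: R) h =
   if h < l then nth 0 L h else if h == l then m else nth 0 R (h - l.+1).
  rewrite nth_cat sL; case: ltngtP => // [lh|->]; last by rewrite subnn.
  by rewrite -[h - l]prednK ?subn_gt0 // /= subnS.
(* Case on the position of the letter playing 2. In [L], the larger letter playing 3 must also be in
   [L], so the whole pattern is. At [m], no smaller letter follows. In [R], the whole pattern is in
   [R]. *)
rewrite !nthE; case: (ltngtP i l) => [il|li|il].
- case: (ltngtP k l) => [kl|lk|kl]; last 2 first.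
  + by have := bL i il; have := bR (k - l.+1); lia.
  + by have := bL i il; lia.
  by rewrite (ltn_trans jk kl); apply: avL; lia.
- rewrite !ifN; try lia.
  by apply: avR; lia.
- rewrite !ifN; try lia.
  by have := bR (j - l.+1); lia.
Qed.

Lemma AV_uniq (n m : nat) : uniq (AV n m).
Proof. exact/filter_uniq/permutations_uniq. Qed.

Lemma perm_AV (n m : nat) :
  perm_eq (AV n.+1 m)
    [seq LR.1 ++ m :: LR.2 | l <- iota 0 n.+1,
       LR <- [seq (L, R) | L <- AV l (m.+1 + (n - l)), R <- AV (n - l) m.+1]].
Proof.
apply: uniq_perm; first exact: AV_uniq.
  apply: allpairs_uniq_dep; first exact: iota_uniq.
    move=> l _; apply: allpairs_uniq; try exact: AV_uniq.
    by case=> ? ? [].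
  move=> _ _ /allpairsPdep[l [[L R] [_ LR ->]]]
    /allpairsPdep[l' [[L' R'] [_ LR' ->]]] /=.
  have {LR} LA : L \in AV l (m.+1 + (n - l)).
    by case/allpairsP: LR => -[L1 R1] [/= LA _ [-> _]].
  have {LR'} LA' : L' \in AV l' (m.+1 + (n - l')).
    by case/allpairsP: LR' => -[L1 R1] [/= LA' _ [-> _]].
  have mL k (K : seq nat) : K \in AV k (m.+1 + (n - k)) -> m \notin K.
    by move=> KA; apply/negP => /(mem_AV_bounds KA); lia.
  (* Since [m] does not occur in [L] or [L'], cutting the word before its first [m] recovers the
     left factor. *)
  move=> E; have EL : L = L'.
    have idx K r : m \notin K -> index m (K ++ m :: r) = size K.
      by move=> /negPf mK; rewrite index_cat mK /= eqxx addn0.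
    have := congr1 (fun v => take (index m v) v) E.
    by rewrite !idx ?(mL _ _ LA) ?(mL _ _ LA') // !take_size_cat.
  move: E; rewrite EL => /eqP; rewrite eqseq_cat // => /andP[_ /eqP[->]].
  by rewrite -(size_AV LA) -(size_AV LA') EL.
move=> w; apply/AV_decompP/allpairsPdep => [[l [L [R [ln LA RA ->]]]]|].
  exists l, (L, R); split=> //; first by rewrite mem_iota.
  by apply/allpairsP; exists (L, R).
move=> [l [[L R] [ln /allpairsP[[L1 R1] [/= LA RA [-> ->]]] ->]]].
by exists l, L1, R1; move: ln; rewrite mem_iota.
Qed.

Lemma sum_AV (V : nmodType) (f : seq nat -> V) (n m : nat) :
  (\sum_(w <- AV n.+1 m) f w =
   \sum_(0 <= l < n.+1) \sum_(L <- AV l (m.+1 + (n - l)))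
     \sum_(R <- AV (n - l) m.+1) f (L ++ m :: R))%R.
Proof.
rewrite (perm_big _ (perm_AV n m)) big_allpairs_dep /=.
by apply: eq_bigr => l _; rewrite big_allpairs_dep.
Qed.

Lemma stats_AV_decomp (n m l : nat) (L R : seq nat) :
  0 < m -> l <= n -> L \in AV l (m.+1 + (n - l)) -> R \in AV (n - l) m.+1 ->
  [/\ wdes (L ++ m :: R) = wdes L + wdes R + (0 < l),
      wdd (L ++ m :: R) = wdd L + wdd R + ((0 < l) && (n - l == 0)) &
      wadi (L ++ m :: R) = wadi L + wadi R + l * (n - l + (0 < n - l))].
Proof.
move=> m0 ln LA RA.
have ltmL : {in L, forall x, m < x} by move=> x /(mem_AV_bounds LA); lia.
have ltmR : {in R, forall x, m < x} by move=> x /(mem_AV_bounds RA); lia.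
have ltRL : {in L & R, forall x y, y < x}.
  by move=> x y /(mem_AV_bounds LA) + /(mem_AV_bounds RA); lia.
by rewrite wdes_decomp ?wdd_decomp ?wadi_decomp // (size_AV LA) (size_AV RA).
Qed.

(** Without double descents, [0 < l] forces a nonempty [R]; the halved bounds then leave
    [(l - 1) + (r - 1) + 2 = n], room for exactly one more descent. The bound makes the exponents of
    [1 + t] genuine differences. *)
Lemma wdes_le_half (n m : nat) (w : seq nat) :
  0 < m -> w \in AV n m -> wdd w = 0 -> (wdes w).*2 <= n.-1.
Proof.
elim/ltn_ind: n m w => -[|n] IH m w m0 wA.
  by rewrite /wdes (size_AV wA) big_geq.
case/AV_decompP: wA => l [L [R [ln LA RA ->]]].
have [-> -> _] := stats_AV_decomp m0 ln LA RA.
move=> dd0; have := IH l _ _ _ _ LA; have := IH (n - l) _ _ _ _ RA.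
by lia.
Qed.

(** * Pattern containment and reverse-complementation of permutations *)

Local Arguments pv : simpl never.

Lemma pv_ord (n : nat) (s : 'S_n) (b : nat) (i : 'I_n) : pv s b i.+1 = (s i).+1.
Proof. by rewrite /pv valK. Qed.

Lemma pv_gt (n : nat) (s : 'S_n) (b i : nat) : n < i -> pv s b i = b.
Proof. by case: i => // i ni; rewrite /pv insubN // -leqNgt. Qed.

Lemma contains213P (n : nat) (s : 'S_n) :
  reflect (exists i j k : 'I_n, [/\ i < j, j < k, s j < s i & s i < s k])
          (contains s [:: 2; 1; 3]).
Proof.
apply: (iffP existsP) => /= [[f /forallP fP]|[i [j [k [ij jk ji ik]]]]].
  pose o0 : 'I_3 := inord 0; pose o1 : 'I_3 := inord 1; pose o2 : 'I_3 := inord 2.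
  move: (fP o0) (fP o1) => /forallP f0 /forallP f1.
  exists (f o0), (f o1), (f o2); move: (f0 o1) (f0 o2) (f1 o0) (f1 o2).
  by rewrite /= !inordK //= => ? ? ? ?; split; lia.
exists [ffun a : 'I_3 => nth i [:: i; j; k] a].
apply/forallP => -[[|[|[|//]]] a3]; apply/forallP => -[[|[|[|//]]] b3];
  by rewrite /= !ffunE /=; lia.
Qed.

Lemma contains132P (n : nat) (s : 'S_n) :
  reflect (exists i j k : 'I_n, [/\ i < j, j < k, s i < s k & s k < s j])
          (contains s [:: 1; 3; 2]).
Proof.
apply: (iffP existsP) => /= [[f /forallP fP]|[i [j [k [ij jk ji ik]]]]].
  pose o0 : 'I_3 := inord 0; pose o1 : 'I_3 := inord 1; pose o2 : 'I_3 := inord 2.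
  move: (fP o0) (fP o1) (fP o2) => /forallP f0 /forallP f1 /forallP f2.
  exists (f o0), (f o1), (f o2); move: (f0 o1) (f0 o2) (f1 o2) (f2 o1).
  by rewrite /= !inordK //= => ? ? ? ?; split; lia.
exists [ffun a : 'I_3 => nth i [:: i; j; k] a].
apply/forallP => -[[|[|[|//]]] a3]; apply/forallP => -[[|[|[|//]]] b3];
  by rewrite /= !ffunE /=; lia.
Qed.

(** Reverse-complementation, written as conjugation by the order-reversing involution of ['I_n]. *)
Definition rc (n : nat) (s : 'S_n) : 'S_n :=
  (perm (@rev_ord_inj n) * s * perm (@rev_ord_inj n))%g.

Lemma rcE (n : nat) (s : 'S_n) (i : 'I_n) : rc s i = rev_ord (s (rev_ord i)).
Proof. by rewrite !permM !permE. Qed.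

Lemma rcK (n : nat) : involutive (@rc n).
Proof. by move=> s; apply/permP => i; rewrite !rcE !rev_ordK. Qed.

Lemma avoids_rc (n : nat) (s : 'S_n) :
  avoids (rc s) [:: 1; 3; 2] = avoids s [:: 2; 1; 3].
Proof.
congr (~~ _); apply/contains132P/contains213P => -[i [j [k]]].
  rewrite !rcE => -[ij jk ik kj].
  exists (rev_ord k), (rev_ord j), (rev_ord i); have := ltn_ord k.
  by move: ij jk ik kj => /= ? ? ? ? ?; split; lia.
move=> [ij jk ji ik]; exists (rev_ord k), (rev_ord j), (rev_ord i).
rewrite !rcE !rev_ordK /=.
by have := ltn_ord k; have := ltn_ord (s k); split; lia.
Qed.

(** Complementation also exchanges the boundary values 0 and [n.+1], so one formula covers the
    positions 0 and [n.+1] and the two boundary conventions correspond. *)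
Lemma pv_rc (n : nat) (s : 'S_n) (i : nat) :
  i <= n.+1 -> pv (rc s) n.+1 i = n.+1 - pv s 0 (n.+1 - i).
Proof.
case: i => [|i]; first by rewrite subn0 (@pv_gt _ _ _ n.+1).
rewrite ltnS leq_eqVlt => /orP[/eqP->|i_n]; first by rewrite pv_gt // subnn.
have -> : n.+1 - i.+1 = (rev_ord (Ordinal i_n)).+1 by rewrite /=; lia.
by rewrite (@pv_ord _ _ _ (Ordinal i_n)) pv_ord rcE /= subnSK.
Qed.

Lemma pv_le (n : nat) (s : 'S_n) (i : nat) : pv s 0 i <= n.
Proof.
case: (ltnP n i) => [/pv_gt-> //|]; case: i => // i i_n.
by rewrite (@pv_ord _ _ _ (Ordinal i_n)).
Qed.

Lemma pv_rc_lt (n : nat) (s : 'S_n) (i j : nat) : i <= n.+1 -> j <= n.+1 ->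
  (pv (rc s) n.+1 i < pv (rc s) n.+1 j) =
  (pv s 0 (n.+1 - j) < pv s 0 (n.+1 - i)).
Proof.
move=> i_n j_n; rewrite !pv_rc //.
by have := pv_le s (n.+1 - i); have := pv_le s (n.+1 - j); lia.
Qed.

Lemma pv_bound (n : nat) (s : 'S_n) (b i : nat) :
  0 < i <= n -> pv s b i = pv s 0 i.
Proof. by case: i => // i /= i_n; rewrite /pv insubT. Qed.

Lemma des_rc (n : nat) (s : 'S_n) : des (rc s) = des s.
Proof.
rewrite [RHS]/des big_nat_rev; apply: eq_big_nat => i /andP[i0 i_n].
rewrite -!(@pv_bound _ (rc s) n.+1) ?pv_rc_lt; try lia.
have -> : (1 + n - i.+1).+1 = n.+1 - i by lia.
by have -> : 1 + n - i.+1 = n.+1 - i.+1 by lia.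
Qed.

Lemma dd_star_rc (n : nat) (s : 'S_n) : dd_star (rc s) = dd s.
Proof.
rewrite [RHS]/dd big_nat_rev; apply: eq_big_nat => i /andP[i0 i_n].
rewrite !pv_rc_lt; try lia.
have -> : (1 + n.+1 - i.+1).+1 = n.+1 - i.-1 by lia.
have -> : (1 + n.+1 - i.+1).-1 = n.+1 - i.+1 by lia.
have -> : 1 + n.+1 - i.+1 = n.+1 - i by lia.
by rewrite andbC.
Qed.

(** The map [(i, j) -> (n.+1 - j, n.+1 - i)] permutes the triangle. Widening to a square with an
    indicator allows the two sums to be exchanged and reversed independently. *)
Lemma sum_triangle_rev (n : nat) (g : nat -> nat -> nat) :
  \sum_(1 <= i < n.+1) \sum_(i.+1 <= j < n.+1) g i j =
  \sum_(1 <= i < n.+1) \sum_(i.+1 <= j < n.+1) g (n.+1 - j) (n.+1 - i).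
Proof.
have widen (h : nat -> nat -> nat) :
    \sum_(1 <= i < n.+1) \sum_(i.+1 <= j < n.+1) h i j =
    \sum_(1 <= i < n.+1) \sum_(1 <= j < n.+1) (if i < j then h i j else 0).
  apply: eq_bigr => i _; rewrite -big_mkcond /= [LHS](big_nat_widenl _ 1) //.
rewrite !widen [RHS]exchange_big_nat [RHS]big_nat_rev /=.
apply: eq_big_nat => i iB; rewrite [RHS]big_nat_rev /=.
apply: eq_big_nat => j jB.
have -> : (1 + n.+1 - j.+1 < 1 + n.+1 - i.+1) = (i < j) by lia.
by case: ifP => // _; congr g; lia.
Qed.

(** Under the reflection of pairs, an ascent right after the smaller letter becomes an ascent right
    before the larger one, and an intermediate letter below the smaller one becomes an intermediate
    letter above the larger one. *)
Lemma adi_star_rc (n : nat) (s : 'S_n) : adi_star (rc s) = adi s.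
Proof.
rewrite /adi_star /adi /= [RHS]sum_triangle_rev.
apply: eq_big_nat => i /andP[i0 i_n]; apply: eq_big_nat => j /andP[ij j_n].
rewrite !pv_rc_lt; try lia.
have -> : (n.+1 - i).+1 = n.+1 - i.-1 by lia.
congr (nat_of_bool (_ && (_ || _))).
apply/hasP/hasP => -[l]; rewrite mem_index_iota => lB.
  rewrite pv_rc_lt; try lia.
  by exists (n.+1 - l) => //; rewrite mem_index_iota; lia.
exists (n.+1 - l); first by rewrite mem_index_iota; lia.
rewrite pv_rc_lt; try lia.
by rewrite subKn //; lia.
Qed.

(** * From permutations to words *)

Definition word (n : nat) (s : 'S_n) : seq nat := mkseq (fun i => pv s 0 i.+1) n.

Lemma size_word (n : nat) (s : 'S_n) : size (word s) = n.
Proof. exact: size_mkseq. Qed.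

Lemma bnth_word (n : nat) (s : 'S_n) (i : nat) : bnth (word s) i = pv s 0 i.
Proof.
case: i => // i; rewrite /bnth /=; case: (ltnP i n) => i_n.
  by rewrite nth_mkseq.
by rewrite nth_default ?size_word // pv_gt.
Qed.

Lemma des_word (n : nat) (s : 'S_n) : des s = wdes (word s).
Proof. by rewrite /wdes size_word; apply: eq_bigr => i _; rewrite !bnth_word. Qed.

Lemma dd_word (n : nat) (s : 'S_n) : dd s = wdd (word s).
Proof. by rewrite /wdd size_word; apply: eq_bigr => i _; rewrite !bnth_word. Qed.

Lemma adi_word (n : nat) (s : 'S_n) : adi s = wadi (word s).
Proof.
rewrite /wadi size_word; apply: eq_bigr => i _; apply: eq_bigr => j _.
rewrite /wadi_pair !bnth_word; congr (nat_of_bool (_ && (_ || _))).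
by apply: eq_has => l; rewrite !bnth_word.
Qed.

Lemma nth_word (n : nat) (s : 'S_n) (i : 'I_n) : nth 0 (word s) i = (s i).+1.
Proof. by rewrite nth_mkseq // pv_ord. Qed.

Lemma avoids_word (n : nat) (s : 'S_n) : avoids s [:: 2; 1; 3] = av213 (word s).
Proof.
rewrite /avoids; apply/idP/av213P => [/contains213P avs i j k ij jk|avs].
  rewrite size_word => k_n; have j_n := ltn_trans jk k_n.
  have i_n := ltn_trans ij j_n.
  rewrite (nth_word s (Ordinal i_n)) (nth_word s (Ordinal j_n)).
  rewrite (nth_word s (Ordinal k_n)) !ltnS => ji ik; apply: avs.
  by exists (Ordinal i_n), (Ordinal j_n), (Ordinal k_n).
apply/contains213P => -[i [j [k [ij jk ji ik]]]].
by apply: (avs i j k) => //; rewrite ?size_word ?nth_word.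
Qed.

Lemma word_inj (n : nat) : injective (@word n).
Proof.
move=> s s' E; apply/permP => i; apply/val_inj.
by have := congr1 (nth 0 ^~ i) E; rewrite !nth_word => -[].
Qed.

Lemma perm_word (n : nat) (s : 'S_n) : perm_eq (word s) (iota 1 n).
Proof.
have uw : uniq (word s).
  apply/(uniqP 0) => i j; rewrite !inE size_word => i_n j_n.
  rewrite (nth_word s (Ordinal i_n)) (nth_word s (Ordinal j_n)) => -[].
  by move/val_inj/perm_inj => -[].
have sub : {subset word s <= iota 1 n}.
  move=> x /(nthP 0)[i]; rewrite size_word => i_n <-.
  rewrite (nth_word s (Ordinal i_n)) mem_iota /=.
  by have := ltn_ord (s (Ordinal i_n)); lia.
apply: uniq_perm => //; first exact: iota_uniq.
by have [] := uniq_min_size uw sub _; rewrite ?size_word ?size_iota.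
Qed.

(** The map [word] is injective into the rearrangements of [iota 1 n], and there are [n!] objects on
    both sides. *)
Lemma perm_words (n : nat) :
  perm_eq [seq word s | s <- enum 'S_n] (permutations (iota 1 n)).
Proof.
have uw : uniq [seq word s | s <- enum 'S_n].
  by rewrite map_inj_uniq ?enum_uniq //; exact: word_inj.
apply: uniq_perm => //; first exact: permutations_uniq.
have [] // := uniq_min_size uw (s2 := permutations (iota 1 n)).
  by move=> _ /mapP[s _ ->]; rewrite mem_permutations perm_word.
by rewrite size_permutations ?iota_uniq // size_iota size_map -cardE card_Sn.
Qed.

(** * Weights of words and the common recurrence *)

Local Open Scope ring_scope.

Section GammaExpansion.

Variables (K : comNzRingType) (t q : K).

Definition weight (w : seq nat) : K := t ^+ wdes w * q ^+ wadi w.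

(** The term of a word in the gamma expansion, extended by 0 to words with a double descent so that
    both generating functions are sums over the same [AV n m]. *)
Definition gweight (w : seq nat) : K :=
  if wdd w == 0%N then
    q ^+ wadi w * t ^+ wdes w * (1 + t) ^+ ((size w).-1 - (wdes w).*2)
  else 0.

(** For fixed [n] the factor [c l] depends only on the lengths, so the sums over [L] and [R]
    separate into a convolution. *)
Lemma sum_AV_mul (f : seq nat -> K) (c : nat -> K) (n m : nat) :
  (forall l L R, (l <= n)%N -> L \in AV l (m.+1 + (n - l)) ->
     R \in AV (n - l) m.+1 -> f (L ++ m :: R) = c l * (f L * f R)) ->
  \sum_(w <- AV n.+1 m) f w =
  \sum_(0 <= l < n.+1) c l * ((\sum_(w <- AV l (m.+1 + (n - l))) f w) *
                               \sum_(w <- AV (n - l) m.+1) f w).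
Proof.
move=> fE; rewrite sum_AV; apply: eq_big_nat => l /andP[_ ln].
rewrite mulr_suml mulr_sumr big_seq [RHS]big_seq; apply: eq_bigr => L LA.
rewrite mulr_sumr mulr_sumr big_seq [RHS]big_seq; apply: eq_bigr => R RA.
exact: fE.
Qed.

Definition coef_weight (l r : nat) : K :=
  t ^+ (0 < l)%N * q ^+ (l * (r + (0 < r))).

Definition coef_gweight (l r : nat) : K :=
  if l == 0%N then (1 + t) ^+ (0 < r)%N
  else if r == 0%N then 0 else t * q ^+ (l * r.+1).

Lemma weight_decomp (n m l : nat) (L R : seq nat) :
  (0 < m)%N -> (l <= n)%N ->
  L \in AV l (m.+1 + (n - l)) -> R \in AV (n - l) m.+1 ->
  weight (L ++ m :: R) = coef_weight l (n - l) * (weight L * weight R).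
Proof.
move=> m0 ln LA RA; have [dE _ aE] := stats_AV_decomp m0 ln LA RA.
by rewrite /weight /coef_weight dE aE !exprD; ring.
Qed.

(** The exponent of [1 + t] for the whole word is [n] minus twice its descents. If [l] and [r] are
    positive, the new descent lowers it by 2, matching [(l - 1) + (r - 1) = n - 2]; if [l = 0 < r],
    one factor [1 + t] is left over. *)
Lemma gweight_decomp (n m l : nat) (L R : seq nat) :
  (0 < m)%N -> (l <= n)%N ->
  L \in AV l (m.+1 + (n - l)) -> R \in AV (n - l) m.+1 ->
  gweight (L ++ m :: R) = coef_gweight l (n - l) * (gweight L * gweight R).
Proof.
move=> m0 ln LA RA; have [dE ddE aE] := stats_AV_decomp m0 ln LA RA.
rewrite /gweight ddE !addn_eq0 eqb0.
case: eqP => [ddL|_]; last by rewrite mul0r mulr0.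
case: eqP => [ddR|_]; last by rewrite !mulr0.
have hL : ((wdes L).*2 <= l.-1)%N by apply: wdes_le_half LA ddL; lia.
have hR : ((wdes R).*2 <= (n - l).-1)%N by apply: wdes_le_half RA ddR.
rewrite /coef_gweight dE aE size_cat /= (size_AV LA) (size_AV RA).
case: (posnP l) hL => [l0|l_gt0] hL.
  (* The summand [0 - (wdes L).*2] is the exponent contributed by [gweight L] for the empty [L]. *)
  rewrite l0 /= subn0 mul0n !addn0 /= (_ : (n - _)%N =
    ((0 < n)%N + (0 - (wdes L).*2) + (n.-1 - (wdes R).*2))%N); last lia.
  by rewrite !exprD; ring.
case: (posnP (n - l)) => [->|nl_gt0]; first by rewrite mul0r.
rewrite ?eqn0Ngt ?l_gt0 ?nl_gt0 /= addn1.
rewrite (_ : (_ - (_ + _).*2)%N =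
    (l.-1 - (wdes L).*2 + ((n - l).-1 - (wdes R).*2))%N); last lia.
by rewrite !exprD; ring.
Qed.

(* For [n > 0] the two coefficient families differ only at the ends [l = 0] and [l = n],
   where [1] and [t] are replaced by [1 + t] and [0]. *)
Lemma sum_coef_weight (G : nat -> K) (n : nat) : G 0%N = G n ->
  \sum_(0 <= l < n.+1) coef_weight l (n - l) * G l =
  \sum_(0 <= l < n.+1) coef_gweight l (n - l) * G l.
Proof.
case: n => [|n] G0n.
  by rewrite !big_nat1 /coef_weight /coef_gweight mul0n !expr0 mul1r.
(* The end terms are [G 0 + t * G n] on the left and [(1 + t) * G 0] on the right. *)
rewrite [LHS]big_nat_recr // [RHS]big_nat_recr //= (big_ltn (m := 0)) //.
rewrite [in RHS](big_ltn (m := 0)) // subnn subn0.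
rewrite (eq_big_nat _ _ (F2 := fun l => coef_gweight l (n.+1 - l) * G l)).
  rewrite /coef_weight /coef_gweight mul0n muln0 expr0 mul0r G0n /= expr1 expr0.
  by move: (bigop _ _ _) (G _) => S g; ring.
move=> l ln; have [l0 r0] : (0 < l)%N /\ (0 < n.+1 - l)%N by lia.
by rewrite /coef_weight /coef_gweight !eqn0Ngt l0 r0 addn1 expr1.
Qed.

(** Strong induction on the length, for all alphabets at once because the factors live on shifted
    intervals. *)
Lemma sum_weight_gweight (n m : nat) : (0 < m)%N ->
  \sum_(w <- AV n m) weight w = \sum_(w <- AV n m) gweight w.
Proof.
elim/ltn_ind: n m => -[|n] IH m m0.
  apply: eq_big_seq => w /size_AV/size0nil->.
  by rewrite /weight /gweight /wdes /wdd /wadi /= !big_geq // !expr0 !mulr1.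
rewrite (sum_AV_mul (fun l L R => @weight_decomp n m l L R m0)).
rewrite (sum_AV_mul (fun l L R => @gweight_decomp n m l L R m0)).
rewrite -(sum_coef_weight (G := fun l =>
  (\sum_(w <- AV l (m.+1 + (n - l))) gweight w) *
    \sum_(w <- AV (n - l) m.+1) gweight w)); last first.
  (* The terms [l = 0] and [l = n] have the same two factors in opposite order, since [AV 0] does
     not depend on the start of the alphabet. *)
  by rewrite mulrC subn0 subnn addn0.
by apply: eq_big_nat => l ln; rewrite !IH //; lia.
Qed.

End GammaExpansion.

(** * Return to permutations and conclusion *)

Lemma sum_avoids_word (V : nmodType) (n : nat) (f : seq nat -> V) :
  \sum_(s : 'S_n | avoids s [:: 2; 1; 3]%N) f (word s) = \sum_(w <- AV n 1) f w.
Proof.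
rewrite /AV big_filter -(perm_big _ (perm_words n)) big_map big_enum_cond /=.
by apply: eq_bigl => s; rewrite avoids_word.
Qed.

(** After exchanging the sums, an avoider without double descents is counted only at [k = des s],
    and any other avoider at no [k]. *)
Lemma sum_Stilde213 (K : comNzRingType) (n : nat) (t q : K) :
  \sum_(0 <= k < (n.-1)./2.+1)
     (\sum_(s : 'S_n | Stilde213 k s) q ^+ adi s)
       * t ^+ k * (1 + t) ^+ (n.-1 - k.*2) =
  \sum_(w <- AV n 1) gweight t q w.
Proof.
rewrite -sum_avoids_word.
under eq_bigr => k _ do rewrite -mulrA mulr_suml.
rewrite (exchange_big_dep (fun s : 'S_n => avoids s [:: 2; 1; 3]%N)) /=; last first.
  by move=> k s _ /and3P[].
apply: eq_bigr => s avs; rewrite /gweight -dd_word -des_word -adi_word size_word.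
case: eqP => [dd0|/eqP/negPf dd0]; last first.
  by rewrite big_pred0 // => k; rewrite /Stilde213 dd0 andbF.
rewrite (eq_bigl (pred1 (des s))) => [|k]; last first.
  by rewrite /Stilde213 avs dd0 eqxx /= eq_sym.
(* The index [k = des s] lies within the range of summation. *)
have desB : (des s <= n.-1./2)%N.
  rewrite des_word geq_half_double.
  by apply: (@wdes_le_half n 1);
    rewrite ?mem_AV -?avoids_word -?dd_word ?avs ?perm_word.
by rewrite big_nat1_eq ltnS desB mulrA.
Qed.

(* Polynomial identity in t, q stated for arbitrary t, q in any commutative ring
   (equivalent to the identity in Z[t,q]). *)
Theorem theorem1p3 (R : comNzRingType) (n : nat) (t q : R) : (1 <= n)%N ->
  let A := \sum_(s : 'S_n | avoids s [:: 2; 1; 3]%N) t ^+ des s * q ^+ adi s in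
  let B := \sum_(s : 'S_n | avoids s [:: 1; 3; 2]%N) t ^+ des s * q ^+ adi_star s in
  let C := \sum_(0 <= k < (n.-1)./2.+1)
             (\sum_(s : 'S_n | Stilde213 k s) q ^+ adi s)
               * t ^+ k * (1 + t) ^+ (n.-1 - k.*2) in
  let D := \sum_(0 <= k < (n.-1)./2.+1)
             (\sum_(s : 'S_n | Stilde132 k s) q ^+ adi_star s)
               * t ^+ k * (1 + t) ^+ (n.-1 - k.*2) in
  [/\ A = B, B = C & C = D].
Proof.
move=> _ A B C D.
have AB : A = B.
  rewrite /B (reindex_inj (can_inj (@rcK n))) /=.
  apply: eq_big => s; first by rewrite avoids_rc.
  by rewrite des_rc adi_star_rc.
have CD : C = D.
  apply: eq_bigr => k _; congr (_ * _ * _).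
  rewrite [RHS](reindex_inj (can_inj (@rcK n))) /=.
  apply: eq_big => s; last by rewrite adi_star_rc.
  by rewrite /Stilde132 avoids_rc des_rc dd_star_rc.
split=> //; rewrite -AB /C sum_Stilde213 -sum_weight_gweight // -sum_avoids_word.
by apply: eq_bigr => s _; rewrite /weight des_word adi_word.
Qed.
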